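(* Let $n\ge1$, let $\Omega\subset\mathbb H^n$ be open and $2\le p\le4$. Let $A=(A_1,\dots,A_{2n}):\Omega\times\mathbb R^{2n}\to\mathbb R^{2n}$ be such that for some $0<\lambda'\le\Lambda'<\infty$, for a.e. $x\in\Omega$, $\xi\in\mathbb R^{2n}$ and all $\eta\in\mathbb R^{2n}$, $$\lambda'|\xi|^{p-2}|\eta|^2\le\sum_{i,j=1}^{2n}\partial_{\xi_j}A_i(x,\xi)\eta_i\eta_j\le\Lambda'|\xi|^{p-2}|\eta|^2,\qquad |A_i(x,\xi)|+|\partial_{x_j}A_i(x,\xi)|\le\Lambda'|\xi|^{p-1}.$$ Then for every $\delta>0$ there exists $A_\delta=(A_{1,\delta},\dots,A_{2n,\delta}):\Omega\times\mathbb R^{2n}\to\mathbb R^{2n}$ such that $A_\delta(x,\xi)\to A(x,\xi)$ as $\delta\to0^+$, and such that the following hold with constants $0<\lambda\le\Lambda<\infty$ depending only on $\lambda',\Lambda'$ (in particular independent of $\delta$ and $\varepsilon$): (a) for a.e. $x\in\Omega$, $\xi\in\mathbb R^{2n}$ and all $\eta\in\mathbb R^{2n}$, $$\lambda(\delta+|\xi|^2)^{\frac{p-2}2}|\eta|^2\le\sum_{i,j=1}^{2n}\partial_{\xi_j}A_{i,\delta}(x,\xi)\eta_i\eta_j\le\Lambda(\delta+|\xi|^2)^{\frac{p-2}2}|\eta|^2,\quad |A_{i,\delta}(x,\xi)|+|\partial_{x_j}A_{i,\delta}(x,\xi)|\le\Lambda(\delta+|\xi|^2)^{\frac{p-1}2};$$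 (b) there is a family $A^\varepsilon_\delta=(A^\varepsilon_{1,\delta},\dots,A^\varepsilon_{2n+1,\delta})$, $\varepsilon>0$, defined for a.e. $x\in\Omega$ and every $\xi\in\mathbb R^{2n+1}$, such that for all $\xi=(\xi_1,\dots,\xi_{2n+1})$, with $\xi^\varepsilon=(\xi_1,\dots,\xi_{2n},\varepsilon\xi_{2n+1})$, $$\big(A^\varepsilon_{1,\delta}(x,\xi^\varepsilon),\dots,A^\varepsilon_{2n+1,\delta}(x,\xi^\varepsilon)\big)\longrightarrow\big(A_{1,\delta}(x,\xi_1,\dots,\xi_{2n}),\dots,A_{2n,\delta}(x,\xi_1,\dots,\xi_{2n}),0\big)\quad\text{as }\varepsilon\to0^+,$$ uniformly on compact subsets of $\Omega$; (c) the family in (b) satisfies, for a.e. $x\in\Omega$, for all $\xi\in\mathbb R^{2n+1}$ and all $\eta\in\mathbb R^{2n+1}$, $$\lambda(\delta+|\xi|^2)^{\frac{p-2}2}|\eta|^2\le\sum_{i,j=1}^{2n+1}\partial_{\xi_j}A^\varepsilon_{i,\delta}(x,\xi)\eta_i\eta_j\le\Lambda(\delta+|\xi|^2)^{\frac{p-2}2}|\eta|^2,\quad |A^\varepsilon_{i,\delta}(x,\xi)|+|\partial_{x_j}A^\varepsilon_{i,\delta}(x,\xi)|\le\Lambda(\delta+|\xi|^2)^{\frac{p-1}2}.$$ Moreover, if a function $A_\delta=(A_{1,\delta},\dots,A_{2n,\delta}):\Omega\times\mathbb R^{2n}\to\mathbb R^{2n}$ satisfies (a) (with constants depending only on $\lambda',\Lambda'$),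 then it also satisfies (b) and (c), with constants depending only on $\lambda',\Lambda'$.
   Context: The Heisenberg group $\mathbb H^n$ is identified with $\mathbb R^{2n+1}$, with points $x=(x_1,\dots,x_{2n+1})$, and with left invariant vector fields $X_i=\partial_{x_i}-\frac{x_{n+i}}2\partial_{x_{2n+1}}$, $X_{n+i}=\partial_{x_{n+i}}+\frac{x_i}2\partial_{x_{2n+1}}$ ($i=1,\dots,n$), $Z=\partial_{x_{2n+1}}$. For $\varepsilon>0$ the Riemannian frame is $X_i^\varepsilon=X_i$ for $i\le2n$ and $X_{2n+1}^\varepsilon=\varepsilon Z$. A vector $\xi=(\xi_1,\dots,\xi_{2n+1})\in\mathbb R^{2n+1}$ denotes the coefficients of $\sum_{i=1}^{2n+1}\xi_iX_i^\varepsilon$ in this frame, and $|\xi|^2=\sum_{i=1}^{2n+1}\xi_i^2$; likewise vectors in $\mathbb R^{2n}$ are coefficients with respect to $X_1,\dots,X_{2n}$, with the Euclidean norm. *)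

(* Defs.v *)
From HB Require Import structures.
From mathcomp Require Import all_boot all_order all_algebra.
From mathcomp Require Import all_classical all_reals all_analysis.
Set Implicit Arguments.
Unset Strict Implicit.
Unset Printing Implicit Defensive.
Import Order.TTheory GRing.Theory Num.Theory numFieldNormedType.Exports.
Local Open Scope classical_set_scope.
Local Open Scope ring_scope.

(* The norm `|x| of the library on 'rV[R]_m is the sup norm. *)
Definition enorm (R : realType) (m : nat) (x : 'rV[R]_m) : R :=
  Num.sqrt (\sum_i x 0 i ^+ 2).

(* Sets of m-dimensional Lebesgue measure zero (m > 0); no measure on R^m is
   available in the library. *)
Definition null_set (R : realType) (m : nat) (N : set 'rV[R]_m) : Prop :=
  forall e : R, 0 < e -> exists a b : nat -> 'rV[R]_m,
    [/\ forall k i, a k 0 i <= b k 0 i,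
        N `<=` \bigcup_k [set x | forall i, a k 0 i <= x 0 i <= b k 0 i] &
        (\sum_(0 <= k <oo) (\prod_i (b k 0 i - a k 0 i))%:E <= e%:E)%E].

Definition ae_in (R : realType) (m : nat) (D : set 'rV[R]_m)
    (P : 'rV[R]_m -> Prop) : Prop :=
  null_set (D `\` [set x | P x]).

(* The phrase "for a.e. x in Omega, xi in R^m" leaves open whether "a.e."
   qualifies xi as well; both readings are supported. *)
Variant xi_quantifier := every_xi | almost_every_xi.

Definition for_xi (R : realType) (q : xi_quantifier) (m : nat)
    (P : 'rV[R]_m -> Prop) : Prop :=
  match q with
  | every_xi => forall xi, P xi
  | almost_every_xi => ae_in setT P
  end.

Definition partial (R : realType) (m : nat) (f : 'rV[R]_m -> R) (j : 'I_m)
    (x : 'rV[R]_m) : R :=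
  'D_(delta_mx 0 j) f x.

Definition has_partials (R : realType) (m : nat) (f : 'rV[R]_m -> R)
    (x : 'rV[R]_m) : Prop :=
  forall j, derivable f x (delta_mx 0 j).

(* 'D_v f x is an unspecified value when f is not derivable at x along v,
   hence the explicit existence of the partial derivatives. *)
Definition structure_at (R : realType) (N m : nat) (l L w v : R)
    (F : 'rV[R]_N -> 'rV[R]_m -> 'rV[R]_m)
    (x : 'rV[R]_N) (xi : 'rV[R]_m) : Prop :=
  [/\ forall i, has_partials (fun z => F x z 0 i) xi,
      forall i, has_partials (fun y => F y xi 0 i) x,
      forall eta : 'rV[R]_m,
        l * w * enorm eta ^+ 2
          <= \sum_i \sum_j
               partial (fun z => F x z 0 i) j xi * eta 0 i * eta 0 j
          <= L * w * enorm eta ^+ 2 &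
      forall i j,
        `|F x xi 0 i| + `|partial (fun y => F y xi 0 i) j x| <= L * v].

Definition structure (R : realType) (q : xi_quantifier) (N m : nat)
    (Omega : set 'rV[R]_N) (p l L : R)
    (F : 'rV[R]_N -> 'rV[R]_m -> 'rV[R]_m) : Prop :=
  ae_in Omega (fun x => for_xi q (fun xi =>
    structure_at l L (enorm xi `^ (p - 2)) (enorm xi `^ (p - 1)) F x xi)).

Definition structure_delta (R : realType) (q : xi_quantifier) (N m : nat)
    (Omega : set 'rV[R]_N) (p delta l L : R)
    (F : 'rV[R]_N -> 'rV[R]_m -> 'rV[R]_m) : Prop :=
  ae_in Omega (fun x => for_xi q (fun xi =>
    structure_at l L ((delta + enorm xi ^+ 2) `^ ((p - 2) / 2))
                     ((delta + enorm xi ^+ 2) `^ ((p - 1) / 2)) F x xi)).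

(* The Heisenberg group H^n, as the manifold R^(2n+1). *)
Notation heis R n := 'rV[R]_(2 * n + 1).

Definition dilate (R : realType) (n : nat) (e : R) (xi : 'rV[R]_(2 * n + 1)) :
    'rV[R]_(2 * n + 1) :=
  row_mx (lsubmx xi) (e *: rsubmx xi).

(* D is the set of full measure on which the family Feps is defined; the values
   of Feps outside D are irrelevant here. *)
Definition converges_to_horizontal (R : realType) (n : nat)
    (Omega : set (heis R n))
    (Feps : R -> heis R n -> 'rV[R]_(2 * n + 1) -> 'rV[R]_(2 * n + 1))
    (F : heis R n -> 'rV[R]_(2 * n) -> 'rV[R]_(2 * n)) : Prop :=
  exists D : set (heis R n),
    [/\ D `<=` Omega, ae_in Omega D &
        forall (xi : 'rV[R]_(2 * n + 1)) (K : set (heis R n)),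
          compact K -> K `<=` Omega ->
          {uniform K `&` D,
            (fun x => Feps e x (dilate e xi)) @[e --> 0^'+] -->
            (fun x => row_mx (F x (lsubmx xi)) 0)}].

(* Main.v *)
Require Import Defs.
From HB Require Import structures.
From mathcomp Require Import all_boot all_order all_algebra.
From mathcomp Require Import all_classical all_reals all_analysis.
From mathcomp Require Import ring lra.
Import Order.TTheory GRing.Theory Num.Theory numFieldNormedType.Exports.
Local Open Scope classical_set_scope.
Local Open Scope ring_scope.

(** Regularizing A. The field A_delta(x, xi) = A(x, xi) + c xi, with
    c = delta^((p-2)/2) (and c = 0 when p = 2), has Jacobian form at least a
    multiple of (|xi|^(p-2) + c) |eta|^2, and since 0 <= (p-2)/2 <= 1 the factor
    |xi|^(p-2) + c is comparable to (delta + |xi|^2)^((p-2)/2) with absolute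
    constants (structure_at_regularize). The x-derivatives are unchanged, and
    c tends to 0 with delta.

    Adding the vertical direction. Let G(xi) = (delta + |xi|^2)^((p-2)/2) xi, in
    any number of variables. Its Jacobian form lies between
    (delta + |xi|^2)^((p-2)/2) |eta|^2 and p - 1 <= 3 times that quantity. Given a
    field F of h in R^(2n) with ellipticity constant l, the field on R^(2n+1)
        (F(x, h) - k G(h), 0) + k G(xi),   where h is the horizontal part of xi,
    agrees with (F, 0) on horizontal vectors. If k = l / 3, the ellipticity of F
    absorbs the negative term - k G(h), and k G(xi) remains, which is elliptic in
    all 2n + 1 directions with the weight of the full vector xi
    (structure_at_riemannian_lift). One field thus serves for every eps, and along
    the dilations xi^eps it converges to (F, 0) at a rate independent of x
    (riemannian_lift_converges).

    All these estimates hold at each point (x, xi) separately. If the hypotheses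
    hold only for almost every xi in R^(2n), the conclusion in R^(2n+1) requires
    that the cylinder over a null set is a null set (null_set_cylinder). *)

Set Implicit Arguments.
Unset Strict Implicit.
Unset Printing Implicit Defensive.

(** * Null sets and almost-everywhere statements *)

Lemma null_setS (R : realType) (m : nat) (M N : set 'rV[R]_m) :
  M `<=` N -> Defs.null_set N -> Defs.null_set M.
Proof.
move=> MN nN e e0; have [a [b [ab Ncov Sle]]] := nN _ e0.
by exists a, b; split=> //; exact: subset_trans Ncov.
Qed.

Lemma ae_inS (R : realType) (m : nat) (D : set 'rV[R]_m)
    (P Q : 'rV[R]_m -> Prop) :
  (forall x, D x -> P x -> Q x) -> ae_in D P -> ae_in D Q.
Proof. by move=> PQ; apply: null_setS => x [Dx nQ]; split=> // Px; exact/nQ/PQ. Qed.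

Lemma for_xiS (R : realType) (q : xi_quantifier) (m : nat)
    (P Q : 'rV[R]_m -> Prop) :
  (forall xi, P xi -> Q xi) -> for_xi q P -> for_xi q Q.
Proof.
by case: q => /= PQ hP; [move=> xi; exact: PQ | apply: ae_inS hP => xi _; exact: PQ].
Qed.

(** The k-th set is covered with total volume at most e / 2^(k+1), and the
    resulting double sequence of boxes is enumerated along a bijection of nat
    with nat * nat; the sum is unchanged because all volumes are nonnegative. *)
Lemma null_set_bigcup (R : realType) (m : nat) (N : nat -> set 'rV[R]_m) :
  (forall k, Defs.null_set (N k)) -> Defs.null_set (\bigcup_k N k).
Proof.
move=> nN e e0.
pose vol (c : 'rV[R]_m * 'rV[R]_m) := \prod_i (c.2 0 i - c.1 0 i).
have cover k : exists c : nat -> 'rV[R]_m * 'rV[R]_m,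
    [/\ forall j i, (c j).1 0 i <= (c j).2 0 i,
        N k `<=` \bigcup_j [set x | forall i, (c j).1 0 i <= x 0 i <= (c j).2 0 i] &
        (\sum_(0 <= j <oo) (vol (c j))%:E <= (e / (2 ^ k.+1)%:R)%:E)%E].
  have [|a [b [ab Ncov Sle]]] := nN k (e / (2 ^ k.+1)%:R).
    by rewrite divr_gt0// ltr0n expn_gt0.
  by exists (fun j => (a j, b j)).
have [c cP] := choice cover.
have vol0 (z : nat * nat) : (0 <= (vol (c z.1 z.2))%:E)%E.
  have [le12 _ _] := cP z.1.
  by rewrite lee_fin prodr_ge0// => i _; rewrite subr_ge0.
have /card_esym/ppcard_eqP[f] := card_nat2.
have [g fK gK] := 'bijTT_f.
exists (fun j => (c (f j).1 (f j).2).1), (fun j => (c (f j).1 (f j).2).2).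
split.
- by move=> j i; have [le12 _ _] := cP (f j).1.
- move=> x [k _ Nkx]; have [_ /(_ _ Nkx)[j _ xj] _] := cP k.
  by exists (g (k, j)) => //=; rewrite gK.
- rewrite nneseries_esumT; last by move=> j; exact: vol0 (f j).
  rewrite -(reindex_esum setT setT f (fun z => (vol (c z.1 z.2))%:E)); last first.
    by rewrite setTT_bijective; exists g.
  rewrite [X in esum X _](_ : _ = setT `*`` (fun=> setT)); last exact/seteqP.
  rewrite -(esum_esum (a := fun i j => (vol (c i j))%:E)); last first.
    by move=> i j _ _; exact: vol0 (i, j).
  apply: le_trans (epsilon_trick0 xpredT (ltW e0)).
  rewrite -nneseries_esumT; last by move=> i; apply: esum_ge0 => j _; exact: vol0 (i, j).
  apply: lee_nneseries => i _; first by move=> _; apply: esum_ge0 => j _; exact: vol0 (i, j).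
  rewrite -nneseries_esumT; last by move=> j; exact: vol0 (i, j).
  by have [_ _] := cP i.
Qed.

(** A box of R^m times [-r, r] has 2 r times its volume, so covers of N with
    total volume e / (2 r) give covers of the strip with total volume e. *)
Lemma null_set_strip (R : realType) (m : nat) (N : set 'rV[R]_m) (r : R) :
  0 < r -> Defs.null_set N ->
  Defs.null_set [set xi : 'rV[R]_(m + 1) | N (lsubmx xi) /\ `|rsubmx xi 0 0| <= r].
Proof.
move=> r0 nN e e0.
have [|a [b [ab Ncov Sle]]] := nN (e / (2 * r)); first by rewrite divr_gt0// mulr_gt0.
exists (fun k => row_mx (a k) (const_mx (- r))), (fun k => row_mx (b k) (const_mx r)).
split.
- move=> k i; case: (split_ordP i) => j ->; first by rewrite !row_mxEl.
  by rewrite !row_mxEr !mxE; lra.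
- move=> xi [/Ncov[k _ abxi] xir]; exists k => // i.
  case: (split_ordP i) => j ->; first by rewrite !row_mxEl; have := abxi j; rewrite mxE.
  by rewrite !row_mxEr !mxE -ler_norml (ord1 j); move: xir; rewrite !mxE.
- rewrite (eq_eseriesr (g := fun k => ((2 * r)%:E * (\prod_i (b k 0 i - a k 0 i))%:E)%E)).
    rewrite nneseriesZl//; last first.
      by move=> k _; rewrite lee_fin prodr_ge0// => i _; rewrite subr_ge0.
    have r2 : (0 <= (2 * r)%:E)%E by rewrite lee_fin mulr_ge0// ltW.
    apply: le_trans (lee_wpmul2l r2 Sle) _.
    by rewrite -EFinM lee_fin mulrCA divff ?mulr1// gt_eqF// mulr_gt0.
  move=> k _; rewrite -EFinM big_split_ord/= big_ord1.
  congr EFin; rewrite mulrC; congr (_ * _).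
    by rewrite !row_mxEr !mxE; ring.
  by apply: eq_bigr => i _; rewrite !row_mxEl.
Qed.

(** This is how an exceptional set of horizontal vectors becomes an exceptional
    set of full vectors: N x R is a countable union of bounded strips. *)
Lemma null_set_cylinder (R : realType) (m : nat) (N : set 'rV[R]_m) :
  Defs.null_set N -> Defs.null_set [set xi : 'rV[R]_(m + 1) | N (lsubmx xi)].
Proof.
move=> nN; apply: (null_setS (N := \bigcup_k
  [set xi : 'rV[R]_(m + 1) | N (lsubmx xi) /\ `|rsubmx xi 0 0| <= k.+1%:R])).
  move=> xi Nxi; exists (Num.bound (rsubmx xi 0 0)) => //; split=> //.
  by rewrite ltW// (lt_le_trans (unstable.ltr_norm_bound _))// ler_nat.
apply: null_set_bigcup => k; exact: null_set_strip.
Qed.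

Lemma ae_in_refl (R : realType) (m : nat) (D : set 'rV[R]_m)
    (P : 'rV[R]_m -> Prop) : ae_in D P -> ae_in D D.
Proof. by apply: null_setS => x []. Qed.

Lemma for_xi_cylinder (R : realType) (q : xi_quantifier) (m : nat)
    (P : 'rV[R]_m -> Prop) :
  for_xi q P -> for_xi q (fun xi : 'rV[R]_(m + 1) => P (lsubmx xi)).
Proof.
case: q => /= [hP xi //|hP]; apply: null_setS (null_set_cylinder hP).
by move=> xi [].
Qed.

(** * Euclidean norm and directional derivatives *)

Lemma sqr_enorm (R : realType) (m : nat) (x : 'rV[R]_m) :
  enorm x ^+ 2 = \sum_i x 0 i ^+ 2.
Proof. by rewrite sqr_sqrtr// sumr_ge0// => i _; rewrite sqr_ge0. Qed.

Lemma enorm_ge0 (R : realType) (m : nat) (x : 'rV[R]_m) : 0 <= enorm x.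
Proof. exact: sqrtr_ge0. Qed.

Lemma sqr_enorm_split (R : realType) (m k : nat) (x : 'rV[R]_(m + k)) :
  enorm x ^+ 2 = enorm (lsubmx x) ^+ 2 + enorm (rsubmx x) ^+ 2.
Proof.
rewrite !sqr_enorm big_split_ord/=; congr (_ + _); by apply: eq_bigr => i _; rewrite mxE.
Qed.

Lemma ler_coord_enorm (R : realType) (m : nat) (x : 'rV[R]_m) i :
  `|x 0 i| <= enorm x.
Proof.
rewrite -(@ler_pXn2r _ 2)// ?nnegrE ?enorm_ge0// sqr_enorm real_normK ?num_real//.
by rewrite (bigD1 i)//= lerDl sumr_ge0// => j _; rewrite sqr_ge0.
Qed.

Lemma cauchy_schwarz (R : realType) (m : nat) (x y : 'rV[R]_m) :
  (\sum_i x 0 i * y 0 i) ^+ 2 <= enorm x ^+ 2 * enorm y ^+ 2.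
Proof.
rewrite !sqr_enorm.
have sumM (f g : 'I_m -> R) :
    (\sum_i f i) * (\sum_j g j) = \sum_i \sum_j f i * g j.
  by rewrite mulr_suml; apply: eq_bigr => i _; rewrite mulr_sumr.
(* Lagrange's identity: the defect in the inequality is half a sum of squares. *)
have : 0 <= \sum_i \sum_j (x 0 i * y 0 j - x 0 j * y 0 i) ^+ 2.
  by apply: sumr_ge0 => i _; apply: sumr_ge0 => j _; exact: sqr_ge0.
have -> : \sum_i \sum_j (x 0 i * y 0 j - x 0 j * y 0 i) ^+ 2 =
    \sum_i \sum_j x 0 i ^+ 2 * y 0 j ^+ 2
    + \sum_i \sum_j y 0 i ^+ 2 * x 0 j ^+ 2
    - 2 * \sum_i \sum_j (x 0 i * y 0 i) * (x 0 j * y 0 j).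
  rewrite -big_split/= mulr_sumr -sumrB; apply: eq_bigr => i _.
  rewrite -big_split/= mulr_sumr -sumrB; apply: eq_bigr => j _; ring.
rewrite -!sumM expr2; lra.
Qed.

Lemma is_derive_coord (R : realType) (m : nat) (x v : 'rV[R]_m) i :
  is_derive x v (fun z : 'rV[R]_m => z 0 i) (v 0 i).
Proof.
apply: DeriveDef.
  by apply: diff_derivable; exact: differentiable_coord.
rewrite /derive; apply/cvg_lim => //.
apply: cvg_near_cst; near=> h; rewrite /= !mxE addrK.
have h0 : h != 0 by near: h; exact: nbhs_dnbhs_neq.
by rewrite /GRing.scale/= mulrA mulVf// mul1r.
Unshelve. all: by end_near. Qed.

Lemma is_derive_addcst (R : realType) (N : nat) (f g : 'rV[R]_N -> R) (b : R) x v :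
  (forall y, g y = f y + b) -> derivable f x v -> is_derive x v g ('D_v f x).
Proof.
move=> gE /derivableP df.
have -> : g = f + cst b by apply/funext => y; rewrite gE.
by apply: is_derive_eq; rewrite addr0.
Qed.

(** Restricted to the line through x directed by v, f becomes a function of one
    real variable, to which the one-variable chain rule applies. *)
Lemma is_derive_powR_comp (R : realType) (V : normedModType R) (f : V -> R) (x v : V)
    (df s : R) :
  0 < f x -> is_derive x v f df ->
  is_derive x v (fun z => f z `^ s) (s * f x `^ (s - 1) * df).
Proof.
move=> fx0 fdf.
have line (g : V -> R) dg : is_derive x v g dg <->
    is_derive (0 : R) 1 (fun h : R => g (h *: v + x)) dg.
  have gE : 'D_v g x = 'D_1 (fun h : R => g (h *: v + x)) 0.
    rewrite /derive; set g1 := fun h => h^-1 *: _; set g2 := fun h => h^-1 *: _.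
    suff -> : g1 = g2 by [].
    by apply/funext => h; rewrite /g1 /g2 /= addr0 scale0r add0r [_%:A]mulr1.
  split=> -[gd <-].
    by rewrite gE; exact/derivableP/(derivable1P _ _ _).1.
  by rewrite -gE; exact/derivableP/(derivable1P _ _ _).2.
apply/line; move/line : fdf => fdf.
have f0 : 0 < f (0 *: v + x) by rewrite scale0r add0r.
have := @is_derive1_comp _ (fun a => a `^ s) _ 0 _ _ (is_derive1_powR s f0) fdf.
by rewrite scale0r add0r mulrC.
Qed.

(** * The field (d + |xi|^2)^s xi *)

Section radial_field.
Context (R : realType) (m : nat) (d s : R).
Implicit Types xi eta : 'rV[R]_m.

Definition weight xi : R := d + enorm xi ^+ 2.

(** For d > 0 and s = (p - 2) / 2, this is the gradient of
    (d + |xi|^2)^(p/2) / p, the regularized p-energy density. *)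
Definition radial xi : 'rV[R]_m := weight xi `^ s *: xi.

Lemma is_derive_weight xi v :
  is_derive xi v weight (2 * \sum_k xi 0 k * v 0 k).
Proof.
rewrite /weight (_ : (fun z => _) =
    cst d + \sum_(k < m) (fun z : 'rV[R]_m => z 0 k) ^+ 2); last first.
  apply/funext => z; rewrite /= sqr_enorm fctE; congr (_ + _).
  by rewrite fct_sumE.
have dX k : is_derive xi v ((fun z : 'rV[R]_m => z 0 k) ^+ 2)
    ((2%:R * xi 0 k ^+ 1) *: v 0 k).
  exact/is_deriveX/is_derive_coord.
apply: is_derive_eq.
rewrite add0r mulr_sumr; apply: eq_bigr => k _.
by rewrite expr1 /GRing.scale/= mulrA.
Qed.

Hypothesis d0 : 0 < d.

Lemma weight_gt0 xi : 0 < weight xi.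
Proof. by rewrite ltr_wpDr// sqr_ge0. Qed.

Lemma is_derive_radial xi v i :
  is_derive xi v (fun z => radial z 0 i)
    (weight xi `^ s * v 0 i
     + 2 * s * weight xi `^ (s - 1) * (\sum_k xi 0 k * v 0 k) * xi 0 i).
Proof.
have -> : (fun z => radial z 0 i) = (fun z => weight z `^ s) * (fun z => z 0 i).
  by apply/funext => z; rewrite mxE.
apply: is_derive_eq.
  apply: is_deriveM; last exact: is_derive_coord.
  by apply: is_derive_powR_comp (is_derive_weight _ _); exact: weight_gt0.
by rewrite /GRing.scale/=; ring.
Qed.

End radial_field.

(** * Jacobian forms *)

Definition jacobian_exists (R : realType) (m : nat)
    (F : 'rV[R]_m -> 'rV[R]_m) (xi : 'rV[R]_m) : Prop :=
  forall i, has_partials (fun z => F z 0 i) xi.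

Definition jacobian_form (R : realType) (m : nat)
    (F : 'rV[R]_m -> 'rV[R]_m) (xi eta : 'rV[R]_m) : R :=
  \sum_i \sum_j partial (fun z => F z 0 i) j xi * eta 0 i * eta 0 j.

Section jacobian_form_linear.
Context (R : realType) (m : nat) (F G : 'rV[R]_m -> 'rV[R]_m) (c : R).
Context (xi : 'rV[R]_m).
Hypothesis (dF : jacobian_exists F xi) (dG : jacobian_exists G xi).

Let is_derive_lincomb i j :
  is_derive xi (delta_mx 0 j : 'rV[R]_m) (fun z => (F z + c *: G z) 0 i)
    (partial (fun z => F z 0 i) j xi + c * partial (fun z => G z 0 i) j xi).
Proof.
have dcG := is_deriveZ c (derivableP (@dG i j)).
have := is_deriveD (derivableP (@dF i j)) dcG.
by congr is_derive; apply/funext => z; rewrite !mxE.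
Qed.

Lemma jacobian_exists_lincomb : jacobian_exists (fun z => F z + c *: G z) xi.
Proof. by move=> i j; have [] := is_derive_lincomb i j. Qed.

Lemma jacobian_form_lincomb eta :
  jacobian_form (fun z => F z + c *: G z) xi eta =
  jacobian_form F xi eta + c * jacobian_form G xi eta.
Proof.
rewrite /jacobian_form mulr_sumr -big_split/=; apply: eq_bigr => i _.
rewrite mulr_sumr -big_split/=; apply: eq_bigr => j _.
by rewrite /partial; have [_ ->] := is_derive_lincomb i j; rewrite /partial; ring.
Qed.

End jacobian_form_linear.

Section jacobian_form_radial.
Context (R : realType) (m : nat) (d s : R).
Hypothesis d0 : 0 < d.
Implicit Types xi eta : 'rV[R]_m.

Lemma jacobian_exists_radial xi : jacobian_exists (radial d s) xi.
Proof. by move=> i j; have [] := is_derive_radial s d0 xi (delta_mx 0 j) i. Qed.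

(** The first term comes from differentiating xi, the second from
    differentiating the weight. *)
Lemma jacobian_form_radialE xi eta :
  jacobian_form (radial d s) xi eta =
  weight d xi `^ s * enorm eta ^+ 2
  + 2 * s * weight d xi `^ (s - 1) * (\sum_i xi 0 i * eta 0 i) ^+ 2.
Proof.
have sum_delta (f : 'I_m -> R) j : \sum_k f k * (delta_mx 0 j : 'rV[R]_m) 0 k = f j.
  rewrite (bigD1 j)//= mxE !eqxx mulr1 big1 ?addr0// => k /negbTE kj.
  by rewrite mxE kj andbF mulr0.
have -> : jacobian_form (radial d s) xi eta =
    \sum_i (weight d xi `^ s * eta 0 i ^+ 2 + 2 * s * weight d xi `^ (s - 1) *
      (\sum_j xi 0 j * eta 0 j) * (xi 0 i * eta 0 i)).
  apply: eq_bigr => i _.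
  transitivity (\sum_j ((weight d xi `^ s * eta 0 i * eta 0 j) * (delta_mx 0 i : 'rV[R]_m) 0 j
     + 2 * s * weight d xi `^ (s - 1) * (xi 0 i * eta 0 i) * (xi 0 j * eta 0 j))).
    apply: eq_bigr => j _; rewrite /partial.
    have [_ ->] := is_derive_radial s d0 xi (delta_mx 0 j) i.
    by rewrite sum_delta !mxE/= [j == i]eq_sym; ring.
  by rewrite big_split/= sum_delta -mulr_sumr; ring.
by rewrite big_split/= -!mulr_sumr sqr_enorm; ring.
Qed.

Hypothesis s0 : 0 <= s.

Lemma jacobian_form_radial_ge xi eta :
  weight d xi `^ s * enorm eta ^+ 2 <= jacobian_form (radial d s) xi eta.
Proof.
rewrite jacobian_form_radialE lerDl mulr_ge0 ?sqr_ge0//.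
by rewrite !mulr_ge0 ?powR_ge0.
Qed.

(** By Cauchy-Schwarz the rank-one term is at most 2 s |xi|^2 / (d + |xi|^2)
    times the first one. For s = (p - 2) / 2 and p <= 4 the constant
    1 + 2 s = p - 1 is at most 3. *)
Lemma jacobian_form_radial_le xi eta :
  jacobian_form (radial d s) xi eta
    <= (1 + 2 * s) * (weight d xi `^ s * enorm eta ^+ 2).
Proof.
have w0 := weight_gt0 d0 xi.
have wE : weight d xi `^ s = weight d xi `^ (s - 1) * weight d xi.
  rewrite -[X in _ * X]powRr1 ?(ltW w0)// -powRD ?subrK//.
  by rewrite (gt_eqF w0) implybT.
have cs : (\sum_i xi 0 i * eta 0 i) ^+ 2 <= weight d xi * enorm eta ^+ 2.
  by apply: (le_trans (cauchy_schwarz _ _)); rewrite ler_wpM2r ?sqr_ge0// lerDr ltW.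
have q0 : 0 <= 2 * s * weight d xi `^ (s - 1) by rewrite !mulr_ge0 ?powR_ge0.
rewrite jacobian_form_radialE [leRHS]mulrDl mul1r lerD2l wE.
by rewrite (le_trans (ler_wpM2l q0 cs))// !mulrA.
Qed.

End jacobian_form_radial.

Lemma radial_exponent0 (R : realType) (m : nat) :
  radial 1 0 = id :> ('rV[R]_m -> 'rV[R]_m).
Proof. by apply/funext => z; rewrite /radial powRr0 scale1r. Qed.

Lemma jacobian_exists_id (R : realType) (m : nat) (xi : 'rV[R]_m) :
  jacobian_exists id xi.
Proof. by rewrite -radial_exponent0; exact: jacobian_exists_radial. Qed.

Lemma jacobian_form_id (R : realType) (m : nat) (xi eta : 'rV[R]_m) :
  jacobian_form id xi eta = enorm eta ^+ 2.
Proof. by rewrite -radial_exponent0 jacobian_form_radialE// powRr0; ring. Qed.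

Section horizontal_lift.
Context (R : realType) (m k : nat).

Definition hlift (F : 'rV[R]_m -> 'rV[R]_m) (xi : 'rV[R]_(m + k)) :
  'rV[R]_(m + k) := row_mx (F (lsubmx xi)) 0.

Let lsubmx_line h (v x : 'rV[R]_(m + k)) :
  lsubmx (h *: v + x) = h *: lsubmx v + lsubmx x.
Proof. by apply/rowP => i; rewrite !mxE. Qed.

Let lsubmx_delta_l j :
  lsubmx (delta_mx 0 (lshift k j) : 'rV[R]_(m + k)) = delta_mx 0 j.
Proof. by apply/rowP => i; rewrite !mxE eq_lshift. Qed.

Let lsubmx_delta_r j : lsubmx (delta_mx 0 (rshift m j) : 'rV[R]_(m + k)) = 0.
Proof. by apply/rowP => i; rewrite !mxE eq_lrshift. Qed.

Let split_l (i : 'I_m) : fintype.split (lshift k i) = inl i := unsplitK (inl i).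

Let split_r (i : 'I_k) : fintype.split (rshift m i) = inr i := unsplitK (inr i).

Variables (F : 'rV[R]_m -> 'rV[R]_m) (xi : 'rV[R]_(m + k)).
Hypothesis dF : jacobian_exists F (lsubmx xi).

Let is_derive_hlift i j :
  is_derive xi (delta_mx 0 j : 'rV[R]_(m + k)) (fun z => hlift F z 0 i)
    (match fintype.split i, fintype.split j with
     | inl i', inl j' => partial (fun z => F z 0 i') j' (lsubmx xi)
     | _, _ => 0
     end).
Proof.
case: (split_ordP i) => i' ->{i}; last first.
  have -> : (fun z => hlift F z 0 (rshift m i')) = cst 0.
    by apply/funext => z; rewrite /hlift row_mxEr mxE.
  exact: is_derive_cst.
have -> : (fun z => hlift F z 0 (lshift k i')) = (fun z => F (lsubmx z) 0 i').
  by apply/funext => z; rewrite /hlift row_mxEl.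
case: (split_ordP j) => j' ->{j}.
  have /derivableP[] := @dF i' j'; rewrite /partial/= /derivable /derive => h1 h2.
  have E : (fun h : R => h^-1 *: (((fun z : 'rV[R]_(m + k) => F (lsubmx z) 0 i') \o shift xi)
        (h *: delta_mx 0 (lshift k j')) - F (lsubmx xi) 0 i')) =
      (fun h : R => h^-1 *: (((fun z : 'rV[R]_m => F z 0 i') \o shift (lsubmx xi))
        (h *: delta_mx 0 j') - F (lsubmx xi) 0 i')).
    by apply/funext => h; rewrite /= lsubmx_line lsubmx_delta_l.
  by apply: DeriveDef; rewrite /derivable /derive E.
have E : (fun h : R => h^-1 *: (((fun z : 'rV[R]_(m + k) => F (lsubmx z) 0 i') \o shift xi)
        (h *: delta_mx 0 (rshift m j')) - F (lsubmx xi) 0 i')) = cst 0.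
  by apply/funext => h; rewrite /= lsubmx_line lsubmx_delta_r scaler0 add0r subrr scaler0.
by apply: DeriveDef; rewrite /derivable /derive E; [exact: is_cvg_cst|exact: lim_cst].
Qed.

Lemma jacobian_exists_hlift : jacobian_exists (hlift F) xi.
Proof. by move=> i j; have [] := is_derive_hlift i j. Qed.

Lemma jacobian_form_hlift eta :
  jacobian_form (hlift F) xi eta = jacobian_form F (lsubmx xi) (lsubmx eta).
Proof.
have partialE i j : partial (fun z => hlift F z 0 i) j xi = _ :=
  @derive_val _ _ _ _ _ _ _ (is_derive_hlift i j).
rewrite /jacobian_form big_split_ord/= [X in _ + X]big1 ?addr0; last first.
  move=> i _; rewrite big1// => j _.
  by rewrite partialE split_r !mul0r.
apply: eq_bigr => i _.
rewrite big_split_ord/= [X in _ + X]big1 ?addr0; last first.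
  by move=> j _; rewrite partialE split_l split_r !mul0r.
apply: eq_bigr => j _.
by rewrite partialE !split_l !mxE.
Qed.

End horizontal_lift.

(** * Comparison of weights *)

(** Each summand is at most the larger of the two, and 2^s <= 2. *)
Lemma powRD_le (R : realType) (s a b : R) :
  0 <= s -> s <= 1 -> 0 <= a -> 0 <= b -> (a + b) `^ s <= 2 * (a `^ s + b `^ s).
Proof.
move=> s0 s1.
have half u v : 0 <= u -> u <= v -> (u + v) `^ s <= 2 * (u `^ s + v `^ s).
  move=> u0 uv; have v0 := le_trans u0 uv.
  apply: (@le_trans _ _ ((2 * v) `^ s)).
    by rewrite ge0_ler_powR ?nnegrE ?addr_ge0 ?mulr_ge0//; lra.
  rewrite powRM// ler_pM ?powR_ge0//.
    by have := @ler_powR R 2 (ler1n _ _) _ _ s1; rewrite powRr1.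
  by rewrite lerDr powR_ge0.
move=> a0 b0; have [ab|/ltW ba] := leP a b; first exact: half.
by rewrite addrC [_ `^ _ + _]addrC; exact: half.
Qed.

Section weights.
Context (R : realType) (p d : R).
Hypothesis d0 : 0 < d.

Lemma ler_weight_powR (m k : nat) (x : 'rV[R]_m) (y : 'rV[R]_k) (t : R) :
  0 <= t -> enorm x ^+ 2 <= enorm y ^+ 2 -> weight d x `^ t <= weight d y `^ t.
Proof.
move=> t0 xy; rewrite ge0_ler_powR ?nnegrE ?(ltW (weight_gt0 d0 _))//.
by rewrite /weight lerD2l.
Qed.

Lemma enorm_powR (m : nat) (x : 'rV[R]_m) (t : R) :
  enorm x `^ t = (enorm x ^+ 2) `^ (t / 2).
Proof.
by rewrite -powR_mulrn ?enorm_ge0// -powRrM; congr (_ `^ _); lra.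
Qed.

Lemma enorm_powR_le_weight (m : nat) (x : 'rV[R]_m) (t : R) : 0 <= t ->
  enorm x `^ t <= weight d x `^ (t / 2).
Proof.
move=> t0; rewrite enorm_powR ge0_ler_powR ?nnegrE ?sqr_ge0 ?divr_ge0//.
  by rewrite ltW ?weight_gt0.
by rewrite /weight lerDr ltW.
Qed.

(** Size bound for the fields weight^s xi: the missing half power of the weight
    dominates |xi|. *)
Lemma weight_mul_enorm_le (m : nat) (x : 'rV[R]_m) (a : R) :
  0 <= a -> a <= enorm x ->
  weight d x `^ ((p - 2) / 2) * a <= weight d x `^ ((p - 1) / 2).
Proof.
move=> a0 ax; have w0 := weight_gt0 d0 x.
have -> : weight d x `^ ((p - 1) / 2) =
    weight d x `^ ((p - 2) / 2) * weight d x `^ (1 / 2).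
  rewrite -powRD ?(gt_eqF w0) ?implybT//; congr (_ `^ _); lra.
rewrite ler_wpM2l ?powR_ge0// (le_trans ax)//.
by rewrite -[leLHS](powRr1 (enorm_ge0 _)) enorm_powR_le_weight.
Qed.

End weights.

(** * Regularization of the horizontal field *)

(** The term c xi contributes c |eta|^2 to the Jacobian form, which supplies the
    ellipticity that F loses where xi is small against sqrt d; with
    c = d^((p-2)/2), the sum |xi|^(p-2) + c is comparable to
    (d + |xi|^2)^((p-2)/2), with absolute factors because p <= 4. When p = 2 the
    form of F is already uniformly elliptic, whereas d^((p-2)/2) = 1 would not
    vanish with d, so c is taken to be 0. *)
Lemma structure_at_regularize (R : realType) (N m : nat) (p d c l L : R)
    (F : 'rV[R]_N -> 'rV[R]_m -> 'rV[R]_m) (x : 'rV[R]_N) (xi : 'rV[R]_m) :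
  2 <= p -> p <= 4 -> 0 < d -> 0 < l -> l <= L ->
  c = (if p == 2 then 0 else d `^ ((p - 2) / 2)) ->
  structure_at l L (enorm xi `^ (p - 2)) (enorm xi `^ (p - 1)) F x xi ->
  structure_at (Num.min l 1 / 2) (L + 1)
    ((d + enorm xi ^+ 2) `^ ((p - 2) / 2)) ((d + enorm xi ^+ 2) `^ ((p - 1) / 2))
    (fun y z => F y z + c *: z) x xi.
Proof.
move=> p2 p4 d0 l0 lL cE [dxi dx ell bnd].
have s0 : 0 <= (p - 2) / 2 by lra.
have w0 : 0 <= weight d xi `^ ((p - 2) / 2) by exact: powR_ge0.
have c0 : 0 <= c by rewrite cE; case: ifP => // _; exact: powR_ge0.
have cw : c <= weight d xi `^ ((p - 2) / 2).
  rewrite cE; case: ifP => // _; rewrite ge0_ler_powR ?nnegrE ?(ltW d0)//.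
    by rewrite ltW ?weight_gt0.
  by rewrite lerDl sqr_ge0.
have rw : enorm xi `^ (p - 2) <= weight d xi `^ ((p - 2) / 2).
  by rewrite enorm_powR_le_weight//; lra.
have r0 : 0 <= enorm xi `^ (p - 2) by exact: powR_ge0.
have min_l : Num.min l 1 <= l by rewrite ge_min lexx.
have min_1 : Num.min l 1 <= 1 by rewrite ge_min lexx orbT.
have min_0 : 0 < Num.min l 1 by rewrite lt_min l0 ltr01.
have low : Num.min l 1 / 2 * weight d xi `^ ((p - 2) / 2)
    <= l * enorm xi `^ (p - 2) + c.
  rewrite cE; case: eqP => [->|_].
    by rewrite subrr mul0r !powRr0; lra.
  have h : weight d xi `^ ((p - 2) / 2) <=
      2 * (d `^ ((p - 2) / 2) + enorm xi `^ (p - 2)).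
    rewrite (enorm_powR xi) powRD_le ?sqr_ge0 ?(ltW d0)//; lra.
  have D0 : 0 <= d `^ ((p - 2) / 2) by exact: powR_ge0.
  have h1 := ler_wpM2l (ltW min_0) h.
  have h2 := ler_wpM2r D0 min_1.
  have h3 := ler_wpM2r r0 min_l.
  lra.
have upp : l * enorm xi `^ (p - 2) + c <= L * enorm xi `^ (p - 2) + c.
  by rewrite lerD2r ler_wpM2r.
have dA i j : is_derive x (delta_mx 0 j : 'rV[R]_N)
    (fun y => (F y xi + c *: xi) 0 i) (partial (fun y => F y xi 0 i) j x).
  by apply: (is_derive_addcst (b := c * xi 0 i)) (dx i j) => y; rewrite !mxE.
split.
- exact: (@jacobian_exists_lincomb R m (F x) id c xi dxi (@jacobian_exists_id R m xi)).
- by move=> i j; have [] := dA i j.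
- move=> eta.
  have E0 : 0 <= enorm eta ^+ 2 by exact: sqr_ge0.
  rewrite -/(jacobian_form (fun z => F x z + c *: z) xi eta).
  rewrite (jacobian_form_lincomb c dxi (@jacobian_exists_id R m xi)) jacobian_form_id.
  have /andP[ell1 ell2] := ell eta.
  rewrite -/(jacobian_form (F x) xi eta) in ell1 ell2.
  apply/andP; split.
    apply: (le_trans (ler_wpM2r E0 low)); rewrite mulrDl lerD2r//.
  apply: (@le_trans _ _ ((L * enorm xi `^ (p - 2) + c) * enorm eta ^+ 2)).
    by rewrite mulrDl lerD2r.
  rewrite ler_wpM2r// mulrDl mul1r lerD// ler_wpM2l//; lra.
- move=> i j.
  rewrite {1}/partial; have [_ ->] := dA i j.
  rewrite !mxE.
  have h1 : c * `|xi 0 i| <= weight d xi `^ ((p - 1) / 2).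
    apply: le_trans (ler_wpM2r (normr_ge0 _) cw) _.
    by apply: weight_mul_enorm_le => //; exact: ler_coord_enorm.
  have h2 : L * enorm xi `^ (p - 1) <= L * weight d xi `^ ((p - 1) / 2).
    by rewrite ler_wpM2l ?enorm_powR_le_weight//; lra.
  have h3 := bnd i j.
  have h4 := ler_normD (F x xi 0 i) (c * xi 0 i).
  rewrite normrM (ger0_norm c0) in h4.
  rewrite mulrDl mul1r; move: h1 h2; rewrite /weight; lra.
Qed.

(** * Lifting a horizontal field to all directions *)

Section riemannian_lift.
Context (R : realType) (N m : nat) (p d k : R).
Context (F : 'rV[R]_N -> 'rV[R]_m -> 'rV[R]_m).

(** With G the radial field of exponent (p - 2) / 2, this is (F, 0) plus k times
    the difference between G in m + 1 variables and G in m variables. *)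
Definition riemannian_lift (x : 'rV[R]_N) (xi : 'rV[R]_(m + 1)) : 'rV[R]_(m + 1) :=
  hlift (fun h => F x h + (- k) *: radial d ((p - 2) / 2) h) xi
  + k *: radial d ((p - 2) / 2) xi.

(** Write h for the first m coordinates of xi, W and w for the weights to the
    power s at xi and at h, and eta' for the first m coordinates of eta. The form
    of F is at least l w |eta'|^2, that of k G at xi is at least k W |eta|^2, and
    subtracting k G at h costs at most k (1 + 2 s) w |eta'|^2 <= 3 k w |eta'|^2.
    The choice 3 k = l makes the horizontal terms cancel, leaving k W |eta|^2. *)
Lemma structure_at_riemannian_lift (l L : R) x xi :
  2 <= p -> p <= 4 -> 0 < d -> 0 < l -> l <= L -> k = l / 3 ->
  structure_at l L
    ((d + enorm (lsubmx xi) ^+ 2) `^ ((p - 2) / 2))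
    ((d + enorm (lsubmx xi) ^+ 2) `^ ((p - 1) / 2)) F x (lsubmx xi) ->
  structure_at (l / 3) (L + l)
    ((d + enorm xi ^+ 2) `^ ((p - 2) / 2)) ((d + enorm xi ^+ 2) `^ ((p - 1) / 2))
    riemannian_lift x xi.
Proof.
move=> p2 p4 d0 l0 lL kE [dxi dx ell bnd].
set s := (p - 2) / 2; set h := lsubmx xi; set t := (p - 1) / 2.
have s0 : 0 <= s by rewrite /s; lra.
have s1 : 1 + 2 * s <= 3 by rewrite /s; lra.
have t0 : 0 <= t by rewrite /t; lra.
have k0 : 0 < k by rewrite kE; lra.
have hxi : enorm h ^+ 2 <= enorm xi ^+ 2.
  by rewrite (sqr_enorm_split xi) lerDl sqr_ge0.
have wh_le : weight d h `^ s <= weight d xi `^ s by exact: ler_weight_powR.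
have vh_le : weight d h `^ t <= weight d xi `^ t by exact: ler_weight_powR.
have wh0 : 0 <= weight d h `^ s by exact: powR_ge0.
have vh0 : 0 <= weight d h `^ t by exact: powR_ge0.
have dG := @jacobian_exists_radial R (m + 1) d s d0 xi.
have dGh := @jacobian_exists_radial R m d s d0 h.
have dFh := @jacobian_exists_lincomb R m (F x) (radial d s) (- k) h dxi dGh.
have dlift := @jacobian_exists_hlift R m 1 _ xi dFh.
have liftE y i : riemannian_lift y xi 0 i = match fintype.split i with
    | inl i' => F y h 0 i' + k * ((weight d xi `^ s - weight d h `^ s) * h 0 i')
    | inr _ => k * (weight d xi `^ s * xi 0 i)
    end.
  rewrite /riemannian_lift /hlift /radial -/s -/h.
  case: (split_ordP i) => i' ->; rewrite [LHS]mxE ?row_mxEl ?row_mxEr !mxE; ring.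
have dlift_x i j : is_derive x (delta_mx 0 j : 'rV[R]_N)
    (fun y => riemannian_lift y xi 0 i) (match fintype.split i with
    | inl i' => partial (fun y => F y h 0 i') j x
    | inr _ => 0
    end).
  move: (liftE ^~ i); case: (fintype.split i) => i' E.
    exact: is_derive_addcst E (dx i' j).
  rewrite (_ : (fun y => riemannian_lift y xi 0 i) = cst (k * (weight d xi `^ s * xi 0 i))).
    exact: is_derive_cst.
  exact/funext.
split.
- have -> : riemannian_lift x = (fun z =>
      hlift (fun h => F x h + (- k) *: radial d s h) z + k *: radial d s z) by [].
  exact (@jacobian_exists_lincomb R (m + 1) _ _ k xi dlift dG).
- by move=> i j; have [] := dlift_x i j.
- move=> eta.
  rewrite -/(jacobian_form (riemannian_lift x) xi eta).
  rewrite (jacobian_form_lincomb k dlift dG) (jacobian_form_hlift dFh).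
  rewrite (jacobian_form_lincomb (- k) dxi dGh).
  have /andP[] := ell (lsubmx eta).
  rewrite -/(jacobian_form (F x) h (lsubmx eta)) -!/(weight _ _) -/s -/h.
  move=> ell1 ell2.
  have G1 := jacobian_form_radial_ge d0 s0 xi eta.
  have G2 := jacobian_form_radial_le d0 s0 xi eta.
  have H1 := jacobian_form_radial_ge d0 s0 h (lsubmx eta).
  have H2 := jacobian_form_radial_le d0 s0 h (lsubmx eta).
  have E0 : 0 <= enorm (lsubmx eta) ^+ 2 by exact: sqr_ge0.
  have E1 : enorm (lsubmx eta) ^+ 2 <= enorm eta ^+ 2.
    by rewrite (sqr_enorm_split eta) lerDl sqr_ge0.
  have wE : weight d h `^ s * enorm (lsubmx eta) ^+ 2
      <= weight d xi `^ s * enorm eta ^+ 2 by exact: ler_pM.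
  have w0 : 0 <= weight d h `^ s * enorm (lsubmx eta) ^+ 2 by exact: mulr_ge0.
  rewrite -!mulrA in ell1 ell2 *.
  (* Only w |eta'|^2 <= W |eta|^2 and the linear relations between the forms
     matter from here on. *)
  move: (weight d h `^ s * _) (weight d xi `^ s * _) wE w0 ell1 ell2 G1 G2 H1 H2.
  move=> wh w whw wh_ge0 ell1 ell2 G1 G2 H1 H2.
  have w_ge0 := le_trans wh_ge0 whw.
  have G3 := ler_wpM2l (ltW k0) (le_trans G2 (ler_wpM2r w_ge0 s1)).
  have H3 := ler_wpM2l (ltW k0) (le_trans H2 (ler_wpM2r wh_ge0 s1)).
  have G4 := ler_wpM2l (ltW k0) G1.
  have H4 := ler_wpM2l (ltW k0) (le_trans wh_ge0 H1).
  have L0 : 0 <= L by lra.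
  have whL := ler_wpM2l L0 whw.
  rewrite kE in G3 H3 G4 H4 *.
  by apply/andP; split; lra.
- move=> i j.
  rewrite {1}/partial; have [_ ->] := dlift_x i j.
  rewrite liftE -/(weight d xi) -/t.
  have coord_le (i' : 'I_(m + 1)) : weight d xi `^ s * `|xi 0 i'| <= weight d xi `^ t.
    by apply: weight_mul_enorm_le => //; exact: ler_coord_enorm.
  have L0 : 0 <= L by lra.
  have Lvh := ler_wpM2l L0 vh_le.
  have lv : 0 <= l * weight d xi `^ t by rewrite mulr_ge0 ?powR_ge0 ?ltW.
  case: (split_ordP i) => i' iE; last first.
    have := ler_wpM2l (ltW k0) (coord_le i).
    rewrite normr0 !normrM (ger0_norm (ltW k0)) (ger0_norm (powR_ge0 _ _)).
    have := ler_wpM2l L0 (le_trans vh0 vh_le).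
    rewrite kE; lra.
  have hE : h 0 i' = xi 0 (lshift 1 i') by rewrite mxE.
  have := ler_wpM2l (ltW k0) (coord_le (lshift 1 i')).
  have := bnd i' j; rewrite -/(weight d h) -/t -/h => bij.
  have := ler_normD (F x h 0 i') (k * ((weight d xi `^ s - weight d h `^ s) * h 0 i')).
  rewrite !normrM (ger0_norm (ltW k0)).
  have : `|weight d xi `^ s - weight d h `^ s| * `|h 0 i'| <= weight d xi `^ s * `|h 0 i'|.
    by rewrite ler_wpM2r// ger0_norm; lra.
  move=> /(ler_wpM2l (ltW k0)); rewrite hE kE; lra.
Qed.

End riemannian_lift.

Lemma enorm_dilate (R : realType) (n : nat) (e : R) (xi : 'rV[R]_(2 * n + 1)) :
  enorm (dilate e xi) ^+ 2 = enorm (lsubmx xi) ^+ 2 + e ^+ 2 * enorm (rsubmx xi) ^+ 2.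
Proof.
rewrite sqr_enorm_split row_mxKl row_mxKr; congr (_ + _).
by rewrite !sqr_enorm mulr_sumr; apply: eq_bigr => i _; rewrite !mxE exprMn.
Qed.

Lemma cvg_radial_dilate (R : realType) (n : nat) (d s : R) (xi : 'rV[R]_(2 * n + 1)) :
  0 < d ->
  radial d s (dilate e xi) @[e --> 0^'+] --> hlift (radial d s) xi.
Proof.
move=> d0.
have -> : hlift (radial d s) xi =
    (weight d (lsubmx xi) `^ s) *: (row_mx (lsubmx xi) 0 + 0 *: row_mx 0 (rsubmx xi)).
  by rewrite scale0r addr0 scale_row_mx scaler0.
have id_cvg : e @[e --> (0:R)^'+] --> (0:R) by apply: cvg_at_right_filter; exact: cvg_id.
apply: cvgZ.
  have wc : (fun e : R => weight d (dilate e xi)) @ 0^'+ --> weight d (lsubmx xi).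
    under eq_fun do rewrite /weight enorm_dilate expr2.
    rewrite /weight -[X in _ + X]addr0 -[X in _ + (_ + X)](mul0r (enorm (rsubmx xi) ^+ 2)).
    rewrite -[X in X * enorm _ ^+ 2](mul0r 0).
    apply: cvgD; first exact: cvg_cst.
    apply: cvgD; first exact: cvg_cst.
    apply: cvgM; last exact: cvg_cst.
    exact: cvgM.
  have [/derivable1_diffP/differentiable_continuous pc _] :=
    is_derive1_powR s (weight_gt0 d0 (lsubmx xi)).
  exact: (@continuous_cvg _ _ _ _ _ _ (fun a : R => a `^ s) _ pc wc).
have dE e : dilate e xi = row_mx (lsubmx xi) 0 + e *: row_mx 0 (rsubmx xi).
  by rewrite /dilate scale_row_mx scaler0 add_row_mx addr0 add0r.
under eq_fun do rewrite dE.
apply: cvgD; first exact: cvg_cst.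
by apply: cvgZr_tmp.
Qed.

(** F enters the lift and its limit through the same horizontal values, so their
    difference does not depend on x: pointwise convergence of the radial field is
    uniform convergence on all of Omega. *)
Lemma riemannian_lift_converges (R : realType) (n : nat) (Omega : set (heis R n))
    (p d k : R) (F : heis R n -> 'rV[R]_(2 * n) -> 'rV[R]_(2 * n)) :
  0 < d -> ae_in Omega Omega ->
  converges_to_horizontal Omega (fun=> riemannian_lift p d k F) F.
Proof.
move=> d0 aeO; exists Omega; split=> // xi K _ _.
set s := (p - 2) / 2.
have limG : k *: radial d s (dilate e xi) @[e --> 0^'+] --> k *: hlift (radial d s) xi.
  by apply: cvgZ; [exact: cvg_cst|exact: cvg_radial_dilate].
move=> U /= /uniform_nbhs[E [entE EU]].
have [r /= r0 rE] : exists2 r : R, 0 < r & [set xy | ball xy.1 r xy.2] `<=` E.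
  by move: entE; rewrite -entourage_ballE.
have near_r : \forall e \near 0^'+,
    `|k *: hlift (radial d s) xi - k *: radial d s (dilate e xi)| < r.
  by move/cvgrPdist_lt : limG; exact.
apply: (filterS _ near_r) => e er; apply: EU => x _; apply: rE => /=.
rewrite -ball_normE /=.
suff -> : row_mx (F x (lsubmx xi)) 0 - riemannian_lift p d k F x (dilate e xi) =
  k *: hlift (radial d s) xi - k *: radial d s (dilate e xi) by [].
rewrite /riemannian_lift /hlift row_mxKl -/s opprD addrA; congr (_ - _).
by rewrite opp_row_mx add_row_mx scale_row_mx !scaler0 subr0 scaleNr opprD opprK addNKr.
Qed.

(** * The approximation theorem *)

(** The family can be taken constant in eps: the dilation of xi alone turns the
    vertical variable off. *)
Lemma riemannian_lift_approximates (R : realType) (q : xi_quantifier) (n : nat)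
    (Omega : set (heis R n)) (p d l L : R)
    (F : heis R n -> 'rV[R]_(2 * n) -> 'rV[R]_(2 * n)) :
  2 <= p -> p <= 4 -> 0 < d -> 0 < l -> l <= L ->
  structure_delta q Omega p d l L F ->
  exists Feps : R -> heis R n -> 'rV[R]_(2 * n + 1) -> 'rV[R]_(2 * n + 1),
    converges_to_horizontal Omega Feps F /\
    (forall eps : R, 0 < eps ->
       structure_delta q Omega p d (l / 3) (L + l) (Feps eps)).
Proof.
move=> p2 p4 d0 l0 lL sF; exists (fun=> riemannian_lift p d (l / 3) F); split.
  by apply: riemannian_lift_converges => //; exact: ae_in_refl sF.
move=> _ _; apply: ae_inS sF => x _ /for_xi_cylinder; apply: for_xiS => xi.
exact: structure_at_riemannian_lift.
Qed.

Lemma structure_at_weaken (R : realType) (N m : nat) (l l' L L' w v : R)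
    (F : 'rV[R]_N -> 'rV[R]_m -> 'rV[R]_m) (x : 'rV[R]_N) (xi : 'rV[R]_m) :
  0 <= w -> 0 <= v -> l' <= l -> L <= L' ->
  structure_at l L w v F x xi -> structure_at l' L' w v F x xi.
Proof.
move=> w0 v0 ll LL [dxi dx ell bnd]; split=> // [eta|i j].
  have E0 : 0 <= w * enorm eta ^+ 2 by rewrite mulr_ge0 ?sqr_ge0.
  have /andP[ell1 ell2] := ell eta; apply/andP; split.
    by apply: le_trans ell1; rewrite -!mulrA ler_wpM2r.
  by apply: (le_trans ell2); rewrite -!mulrA ler_wpM2r.
by apply: (le_trans (bnd i j)); rewrite ler_wpM2r.
Qed.

Theorem proposition2p2 (R : realType) (q : xi_quantifier) :
  (forall l' L' : R, 0 < l' -> l' <= L' ->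
     exists l L : R, [/\ 0 < l, l <= L &
       forall (n : nat) (Omega : set (heis R n)) (p : R)
              (A : heis R n -> 'rV[R]_(2 * n) -> 'rV[R]_(2 * n)),
         (1 <= n)%N -> open Omega -> 2 <= p -> p <= 4 ->
         structure q Omega p l' L' A ->
         exists Adelta : R -> heis R n -> 'rV[R]_(2 * n) -> 'rV[R]_(2 * n),
           (forall (x : heis R n) (xi : 'rV[R]_(2 * n)), Omega x ->
              Adelta delta x xi @[delta --> 0^'+] --> A x xi) /\
           (forall delta : R, 0 < delta ->
              structure_delta q Omega p delta l L (Adelta delta) /\
              exists Aeps : R -> heis R n ->
                            'rV[R]_(2 * n + 1) -> 'rV[R]_(2 * n + 1),
                converges_to_horizontal Omega Aeps (Adelta delta) /\
                (forall eps : R, 0 < eps ->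
                   structure_delta q Omega p delta l L (Aeps eps)))])
  /\
  (forall la La : R, 0 < la -> la <= La ->
     exists l L : R, [/\ 0 < l, l <= L &
       forall (n : nat) (Omega : set (heis R n)) (p delta : R)
              (Ad : heis R n -> 'rV[R]_(2 * n) -> 'rV[R]_(2 * n)),
         (1 <= n)%N -> open Omega -> 2 <= p -> p <= 4 -> 0 < delta ->
         structure_delta q Omega p delta la La Ad ->
         exists Aeps : R -> heis R n ->
                       'rV[R]_(2 * n + 1) -> 'rV[R]_(2 * n + 1),
           converges_to_horizontal Omega Aeps Ad /\
           (forall eps : R, 0 < eps ->
              structure_delta q Omega p delta l L (Aeps eps))]).
Proof.
split=> [l' L' l'0 l'L'|la La la0 laLa]; last first.
  exists (la / 3), (La + la); split; [lra | lra |].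
  move=> n Omega p delta Ad _ _ p2 p4 d0; exact: riemannian_lift_approximates.
have min_l : Num.min l' 1 <= l' by rewrite ge_min lexx.
have min_0 : 0 < Num.min l' 1 by rewrite lt_min l'0 ltr01.
set l1 := Num.min l' 1 / 2; have l10 : 0 < l1 by rewrite /l1; lra.
have l1L : l1 <= L' + 1 by rewrite /l1; lra.
exists (l1 / 3), (L' + 1 + l1); split; [lra | lra |].
move=> n Omega p A _ _ p2 p4 sA.
pose c (delta : R) := if p == 2 then 0 else delta `^ ((p - 2) / 2).
pose Ad (delta : R) y z := A y z + c delta *: z.
have sAd delta : 0 < delta -> structure_delta q Omega p delta l1 (L' + 1) (Ad delta).
  move=> delta0; apply: ae_inS sA => x _; apply: for_xiS => xi.
  exact: structure_at_regularize.
exists Ad; split=> [x xi _|delta delta0].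
  have c_cvg : c delta @[delta --> 0^'+] --> (0 : R).
    rewrite /c; case: eqP => [_|p_neq2]; first exact: cvg_cst.
    by apply: powR_cvg0; rewrite divr_gt0// subr_gt0 lt_neqAle p2 andbT eq_sym; exact/eqP.
  rewrite -[X in _ --> X]addr0 -[X in _ + X](scale0r xi).
  by apply: cvgD; [exact: cvg_cst | exact: cvgZr_tmp].
split; last exact: riemannian_lift_approximates (sAd _ delta0).
apply: ae_inS (sAd _ delta0) => x _; apply: for_xiS => xi.
by apply: structure_at_weaken; rewrite ?powR_ge0//; lra.
Qed.
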